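(* Let $\iota:(M^m,g)\to(N^n,h)$ be a Riemannian submanifold of a Riemannian manifold, with mean curvature vector $H$ such that $|H|$ is constant. Then $M$ is $H$-tensional if and only if it is minimal.
   Context: A Riemannian submanifold $\iota:(M^m,g)\to(N^n,h)$ is a (connected) manifold $M$ together with an isometric immersion $\iota$. Its mean curvature vector is $H=\frac1m\operatorname{Tr}_g B=\frac1m\tau(\iota)$, where $B$ is the second fundamental form and $\tau(\iota)=\sum_{i=1}^m\{\nabla^\iota_{e_i}d\iota(e_i)-d\iota(\nabla_{e_i}e_i)\}$ is the tension field ($\{e_i\}$ a local orthonormal frame of $(M,g)$, $\nabla$ the Levi-Civita connection of $(M,g)$, $\nabla^\iota$ the connection on $\iota^{-1}TN$ induced by the Levi-Civita connection of $(N,h)$). $M$ is minimal if $H=0$. The rough Laplacian on sections $\xi$ of $\iota^{-1}TN$ is $\Delta^\iota\xi=-\sum_{i=1}^m(\nabla^\iota_{e_i}\nabla^\iota_{e_i}\xi-\nabla^\iota_{\nabla_{e_i}e_i}\xi)$. $M$ is called $H$-tensional if $\Delta^\iota\tau(\iota)=0$. *)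

(* Defs.v *)
From HB Require Import structures.
From mathcomp Require Import all_boot all_order all_algebra.
From mathcomp Require Import all_classical all_reals all_analysis.
From mathcomp Require Import ring.
Set Implicit Arguments.
Unset Strict Implicit.
Unset Printing Implicit Defensive.
Import Order.TTheory GRing.Theory Num.Theory.
Import numFieldNormedType.Exports.
Local Open Scope classical_set_scope.
Local Open Scope ring_scope.

Section Smooth.
Context {R : realType} {V W : normedModType R}.

(* For U open.  Iterated directional derivatives stand for partial derivatives;
   their continuity already implies differentiability in finite dimension. *)
Fixpoint Ck (k : nat) (U : set V) (f : V -> W) : Prop :=
  if k is k'.+1 then
    (forall x, U x -> differentiable f x) /\ (forall v, Ck k' U ('D_v f))
  else forall x, U x -> {for x, continuous f}.

Definition smooth_on (U : set V) (f : V -> W) := forall k, Ck k U f.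

End Smooth.

Section Coordinates.
Context {R : realType}.

Definition inner d (A : 'M[R]_d) (u v : 'rV[R]_d) : R := (u *m A *m v^T) 0 0.

Definition is_inner_product d (A : 'M[R]_d) : Prop :=
  A^T = A /\ forall u : 'rV[R]_d, u != 0 -> 0 < inner A u u.

Definition coord_vec d (i : 'I_d) : 'rV[R]_d := delta_mx 0 i.

(* Gamma^k_(ij) =
   1/2 g^(kl) (partial_i g_(jl) + partial_j g_(il) - partial_l g_(ij));
   [christoffel_levi_civita] shows that these are the coefficients of the
   torsion-free metric connection. *)
Definition christoffel d (g : 'rV[R]_d -> 'M[R]_d) (x : 'rV[R]_d)
    (k i j : 'I_d) : R :=
  2^-1 * \sum_l invmx (g x) k l *
    (('D_(coord_vec i) g x) j l + ('D_(coord_vec j) g x) i l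
     - ('D_(coord_vec l) g x) i j).

Definition christoffel_form d (g : 'rV[R]_d -> 'M[R]_d) (x u v : 'rV[R]_d)
    : 'rV[R]_d :=
  \row_k \sum_i \sum_j christoffel g x k i j * u 0 i * v 0 j.

Definition nabla d (g : 'rV[R]_d -> 'M[R]_d) (X Y : 'rV[R]_d -> 'rV[R]_d)
    (x : 'rV[R]_d) : 'rV[R]_d :=
  'D_(X x) Y x + christoffel_form g x (X x) (Y x).

Definition push m n (f : 'rV[R]_m -> 'rV[R]_n) (X : 'rV[R]_m -> 'rV[R]_m)
    (x : 'rV[R]_m) : 'rV[R]_n := 'D_(X x) f x.

(* the connection on f^{-1}TN; xi is a vector field along f *)
Definition nabla_along m n (f : 'rV[R]_m -> 'rV[R]_n)
    (h : 'rV[R]_n -> 'M[R]_n) (X : 'rV[R]_m -> 'rV[R]_m)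
    (xi : 'rV[R]_m -> 'rV[R]_n) (x : 'rV[R]_m) : 'rV[R]_n :=
  'D_(X x) xi x + christoffel_form h (f x) (push f X x) (xi x).

Definition orthonormal_frame m (W : set 'rV[R]_m) (g : 'rV[R]_m -> 'M[R]_m)
    (e : 'I_m -> 'rV[R]_m -> 'rV[R]_m) : Prop :=
  (forall i, smooth_on W (e i)) /\
  (forall x, W x -> forall i j, inner (g x) (e i x) (e j x) = (i == j)%:R).

Definition tension m n (g : 'rV[R]_m -> 'M[R]_m) (h : 'rV[R]_n -> 'M[R]_n)
    (f : 'rV[R]_m -> 'rV[R]_n) (e : 'I_m -> 'rV[R]_m -> 'rV[R]_m)
    (x : 'rV[R]_m) : 'rV[R]_n :=
  \sum_i (nabla_along f h (e i) (push f (e i)) x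
          - push f (nabla g (e i) (e i)) x).

Definition mean_curvature m n (g : 'rV[R]_m -> 'M[R]_m)
    (h : 'rV[R]_n -> 'M[R]_n) (f : 'rV[R]_m -> 'rV[R]_n)
    (e : 'I_m -> 'rV[R]_m -> 'rV[R]_m) (x : 'rV[R]_m) : 'rV[R]_n :=
  m%:R^-1 *: tension g h f e x.

Definition rough_laplacian m n (g : 'rV[R]_m -> 'M[R]_m)
    (h : 'rV[R]_n -> 'M[R]_n) (f : 'rV[R]_m -> 'rV[R]_n)
    (e : 'I_m -> 'rV[R]_m -> 'rV[R]_m) (xi : 'rV[R]_m -> 'rV[R]_n)
    (x : 'rV[R]_m) : 'rV[R]_n :=
  - \sum_i (nabla_along f h (e i) (nabla_along f h (e i) xi) x
            - nabla_along f h (nabla g (e i) (e i)) xi x).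

End Coordinates.

Record chart (R : realType) (m : nat) (T : topologicalType) := Chart {
  chart_dom : set T ;
  chart_map :> T -> 'rV[R]_m ;
  chart_inv : 'rV[R]_m -> T ;
  chart_dom_open : open chart_dom ;
  chart_img_open : open (chart_map @` chart_dom) ;
  chart_mapK : forall p, chart_dom p -> chart_inv (chart_map p) = p ;
  chart_map_continuous : {within chart_dom, continuous chart_map} ;
  chart_inv_continuous :
    {within chart_map @` chart_dom, continuous chart_inv} }.

Definition transition (R : realType) (m : nat) (T : topologicalType)
    (a b : chart R m T) : 'rV[R]_m -> 'rV[R]_m := b \o chart_inv a.

Record smooth_manifold (R : realType) (m : nat) := SmoothManifold {
  carrier :> topologicalType ;
  manifold_hausdorff : hausdorff_space carrier ;
  manifold_second_countable : @second_countable carrier ;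
  atlas : set (chart R m carrier) ;
  atlas_cover : forall p, exists2 a, atlas a & chart_dom a p ;
  atlas_compatible : forall a b, atlas a -> atlas b ->
    smooth_on (a @` (chart_dom a `&` chart_dom b)) (transition a b) }.

(* The metric is given by its matrix in each chart of the atlas, as a function
   of the coordinates; [metric_transition] makes these matrices represent one
   tensor. *)
Record riemannian_manifold (R : realType) (m : nat) := RiemannianManifold {
  manifold_of :> smooth_manifold R m ;
  metric : chart R m manifold_of -> 'rV[R]_m -> 'M[R]_m ;
  metric_smooth : forall a, atlas a -> smooth_on (a @` chart_dom a) (metric a) ;
  metric_inner : forall a, atlas a ->
    forall p, chart_dom a p -> is_inner_product (metric a (a p)) ;
  metric_transition : forall a b, atlas a -> atlas b ->
    forall p, chart_dom a p -> chart_dom b p -> forall u v,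
    inner (metric a (a p)) u v =
    inner (metric b (b p)) ('D_u (transition a b) (a p))
                           ('D_v (transition a b) (a p)) }.

Section Submanifold.
Context {R : realType} {m n : nat}.
Context {M : riemannian_manifold R m} {N : riemannian_manifold R n}.
Variable iota : M -> N.

Definition overlap (a : chart R m M) (b : chart R n N) : set M :=
  chart_dom a `&` iota @^-1` chart_dom b.

Definition local_rep (a : chart R m M) (b : chart R n N)
    : 'rV[R]_m -> 'rV[R]_n := b \o iota \o chart_inv a.

Definition smooth_map : Prop :=
  continuous iota /\
  forall a b, atlas a -> atlas b -> smooth_on (a @` overlap a b) (local_rep a b).

Definition isometric_immersion : Prop :=
  smooth_map /\
  forall a b, atlas a -> atlas b -> forall p, overlap a b p ->
    injective (fun u => 'D_u (local_rep a b) (a p)) /\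
    forall u v, inner (metric a (a p)) u v =
      inner (metric b (b (iota p))) ('D_u (local_rep a b) (a p))
                                    ('D_v (local_rep a b) (a p)).

(* Tensors on M and sections of iota^{-1}TN are handled through their
   components: a statement about them is required for all charts a of M and b
   of N and all local orthonormal frames e of M, written in the chart a.  Such
   frames exist around every point, see [exists_local_frame]. *)
Definition local_frame (a : chart R m M) (b : chart R n N) (W : set 'rV[R]_m)
    (e : 'I_m -> 'rV[R]_m -> 'rV[R]_m) : Prop :=
  [/\ atlas a, atlas b, open W, W `<=` a @` overlap a b &
      orthonormal_frame W (metric a) e].

Definition constant_mean_curvature_norm : Prop :=
  exists c : R, forall a b W e, local_frame a b W e -> forall x, W x ->
    let f := local_rep a b in
    let H := mean_curvature (metric a) (metric b) f e x in
    Num.sqrt (inner (metric b (f x)) H H) = c.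

Definition minimal : Prop :=
  forall a b W e, local_frame a b W e -> forall x, W x ->
    mean_curvature (metric a) (metric b) (local_rep a b) e x = 0.

Definition H_tensional : Prop :=
  forall a b W e, local_frame a b W e -> forall x, W x ->
    let f := local_rep a b in
    rough_laplacian (metric a) (metric b) f e
      (tension (metric a) (metric b) f e) x = 0.

End Submanifold.

Section SmoothTheory.
Context {R : realType}.
Implicit Types V W X : normedModType R.

Lemma near_differentiable V W (f g : V -> W) (x : V) :
  (\near x, f x = g x) -> differentiable f x -> differentiable g x.
Proof.
move=> fg df.
have -> : g = f + (g - f) by apply/funext => y /=; rewrite !fctE addrC subrK.
apply: differentiableD => //.
set z := g - f.
have z0 : \near x, z x = 0.
  by near=> y; rewrite /z !fctE; apply/eqP; rewrite subr_eq0; apply/eqP/esym; near: y.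
have zx : z x = 0 by exact: nbhs_singleton z0.
pose zero : {linear V -> W} := \0.
have E : z \o shift x = cst (z x) + zero +o_ 0 id.
  apply/eqaddoP => _/posnumP[e].
  have : \forall h \near (0:V), z (h + x) = 0.
    by move: z0; rewrite (near_shift 0 x) /= subr0.
  apply: filterS => h h0.
  rewrite [X in `|X|](_ : _ = z (h + x) - (z x + 0)) //.
  by rewrite h0 zx addr0 subr0 normr0 mulr_ge0.
apply/diff_locallyP.
have cz : continuous zero by move=> y; exact: cst_continuous.
by have -> := @diff_unique _ _ _ z zero x cz E.
Unshelve. all: by end_near. Qed.

Lemma eq_Ck k V W (U : set V) (f g : V -> W) : open U ->
  (forall x, U x -> f x = g x) -> Ck k U f -> Ck k U g.
Proof.
move=> oU; elim: k f g => [|k IH] f g fg /=.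
  move=> fc x Ux; have := fc x Ux.
  rewrite /prop_for /continuous_at -(fg x Ux); apply: cvg_trans.
  apply: near_eq_cvg.
  by apply: filterS (open_nbhs_nbhs (conj oU Ux)) => y /fg.
have nfg x : U x -> \near x, f x = g x.
  by move=> Ux; apply: filterS (open_nbhs_nbhs (conj oU Ux)) => y /fg.
move=> [fd fD]; split=> [x Ux|v].
  by apply: (near_differentiable (nfg _ Ux)); exact: fd.
by apply: (IH ('D_v f)) (fD v) => x Ux; apply: near_eq_derive; exact: nfg.
Qed.

Lemma CkS k V W (U : set V) (f : V -> W) : Ck k.+1 U f -> Ck k U f.
Proof.
elim: k f => [|k IH] f /= [fd fD].
  by move=> x Ux; exact/differentiable_continuous/fd.
by split=> // v; apply: IH; exact: fD.
Qed.

Lemma Ck_cst k V W (U : set V) (c : W) : Ck k U (cst c : V -> W).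
Proof.
elim: k c => [|k IH] c /=; first by move=> x _; exact: cst_continuous.
split=> [x _|v]; first exact: differentiable_cst.
by rewrite (_ : 'D_v _ = cst 0) //; apply/funext => x; rewrite derive_cst.
Qed.

Lemma CkD k V W (U : set V) (f g : V -> W) : open U ->
  Ck k U f -> Ck k U g -> Ck k U (f + g).
Proof.
move=> oU; elim: k f g => [|k IH] f g /=.
  by move=> fc gc x Ux; apply: continuousD; [exact: fc|exact: gc].
move=> [fd fD] [gd gD]; split=> [x Ux|v].
  by apply: differentiableD; [exact: fd|exact: gd].
apply: (@eq_Ck _ _ _ _ ('D_v f + 'D_v g)) => // [x Ux|]; last exact: IH.
by rewrite deriveD//; apply: diff_derivable; [exact: fd|exact: gd].
Qed.

Lemma Ck_linear k V W X (U : set V) (f : V -> W) (L : {linear W -> X}) :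
  open U -> continuous L -> Ck k U f -> Ck k U (L \o f).
Proof.
move=> oU Lc; elim: k f => [|k IH] f /=.
  by move=> fc x Ux; apply: continuous_comp; [exact: fc|exact: Lc].
have Ld y : differentiable L y by exact: linear_differentiable.
move=> [fd fD]; split=> [x Ux|v].
  by apply: differentiable_comp; [exact: fd|exact: Ld].
apply: (@eq_Ck _ _ _ _ (L \o 'D_v f)) => // [x Ux|]; last exact: IH.
have fdx := fd x Ux.
rewrite [RHS]deriveE; last exact: differentiable_comp.
by rewrite diff_comp//= diff_lin// deriveE.
Qed.

Lemma CkM k V (U : set V) (f g : V -> R) : open U ->
  Ck k U f -> Ck k U g -> Ck k U (f * g).
Proof.
move=> oU; elim: k f g => [|k IH] f g.
  by move=> fc gc x Ux; exact: (continuousM (fc x Ux) (gc x Ux)).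
move=> fk gk; have [fd fD] := fk; have [gd gD] := gk; split=> [x Ux|v].
  by apply: differentiableM; [exact: fd|exact: gd].
apply: (@eq_Ck _ _ _ _ (f * 'D_v g + g * 'D_v f)) => // [x Ux|].
  by rewrite deriveM//; apply: diff_derivable; [exact: fd|exact: gd].
apply: CkD => //.
  by apply: IH; [exact: (CkS fk)|exact: gD].
by apply: IH; [exact: (CkS gk)|exact: fD].
Qed.

Lemma Ck_powR k V (U : set V) (f : V -> R) (a : R) : open U ->
  (forall x, U x -> 0 < f x) -> Ck k U f -> Ck k U (fun x => f x `^ a).
Proof.
move=> oU f0; elim: k a => [|k IH] a.
  move=> fc x Ux; apply: (@continuous_comp _ _ _ f (fun t => t `^ a)).
    exact: fc.
  apply: differentiable_continuous; apply/derivable1_diffP.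
  by have [] := is_derive1_powR a (f0 x Ux).
move=> fk; have [fd fD] := fk.
have pd x : U x -> differentiable (fun t : R => t `^ a) (f x).
  move=> Ux; apply/derivable1_diffP.
  by have [] := is_derive1_powR a (f0 x Ux).
split=> [x Ux|v].
  exact: (@differentiable_comp _ _ _ _ f (fun t : R => t `^ a) x (fd x Ux)
    (pd x Ux)).
apply: (@eq_Ck _ _ _ _ (cst a * (fun x => f x `^ (a - 1)) * 'D_v f)) => //.
  move=> x Ux; have fdx := fd x Ux; have pdx := pd x Ux.
  have cdx := @differentiable_comp _ _ _ _ f (fun t : R => t `^ a) x fdx pdx.
  rewrite [RHS](deriveE _ cdx).
  rewrite (@diff_comp _ _ _ _ f (fun t : R => t `^ a))//= -!deriveE//.
  rewrite -['D_v f x in RHS]mulr1 [X in 'D_X _ (f x)](_ : _ = 'D_v f x *: 1)//.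
  rewrite deriveE// linearZ/= -deriveE//.
  have [_ ->] := is_derive1_powR a (f0 x Ux).
  by rewrite !fctE mulrC.
apply: CkM => //; last exact: fD.
apply: CkM => //; first exact: Ck_cst.
by apply: IH; exact: CkS.
Qed.

End SmoothTheory.

Section Frames.
Context {R : realType}.

Lemma smooth_cst (V W : normedModType R) (U : set V) (c : W) :
  smooth_on U (fun=> c : W).
Proof. by move=> k; exact: Ck_cst. Qed.

Lemma smooth_sum (V W : normedModType R) (U : set V) (I : Type) (r : seq I)
    (f : I -> V -> W) : open U -> (forall i, smooth_on U (f i)) ->
  smooth_on U (fun x => \sum_(i <- r) f i x).
Proof.
move=> oU fs k; elim: r => [|i r IH].
  under eq_fun do rewrite big_nil; exact: Ck_cst.
under eq_fun do rewrite big_cons; apply: CkD => //; exact: fs.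
Qed.

Lemma smooth_scale (V W : normedModType R) (U : set V) (c : V -> R) (w : W) :
  open U -> smooth_on U c -> smooth_on U (fun x => c x *: w).
Proof.
move=> oU cs k.
pose f (t : R) := t *: w.
have lf : linear f by move=> a s t; rewrite /f scalerDl scalerA.
pose L : {linear R -> W} := HB.pack f (GRing.isLinear.Build _ _ _ _ _ lf).
by apply: (@Ck_linear _ k V R W U c L) => //; exact: scalel_continuous.
Qed.

Lemma smooth_entry (V : normedModType R) (U : set V) p q (F : V -> 'M[R]_(p, q))
    i j : open U -> smooth_on U F -> smooth_on U (fun x => F x i j).
Proof.
move=> oU Fs k.
pose f (A : 'M[R]_(p, q)) : R := A i j.
have lf : linear f by move=> a s t; rewrite /f !mxE.
pose L : {linear 'M[R]_(p, q) -> R} := HB.pack f (GRing.isLinear.Build _ _ _ _ _ lf).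
by apply: (@Ck_linear _ k V _ R U F L) => //; exact: coord_continuous.
Qed.

Lemma smooth_row (V : normedModType R) (U : set V) d (F : V -> 'rV[R]_d) :
  open U -> (forall j, smooth_on U (fun x => F x 0 j)) -> smooth_on U F.
Proof.
move=> oU Fs.
rewrite (_ : F = fun x => \sum_j F x 0 j *: coord_vec j); last first.
  by apply/funext => x; rewrite [LHS]row_sum_delta.
by apply: smooth_sum => // j; apply: smooth_scale.
Qed.

Lemma smooth_scale_row (V : normedModType R) (U : set V) d (c : V -> R)
    (F : V -> 'rV[R]_d) : open U ->
  smooth_on U c -> smooth_on U F -> smooth_on U (fun x => c x *: F x).
Proof.
move=> oU cs Fs; apply: smooth_row => // j.
rewrite (_ : (fun _ => _) = c * (fun x => F x 0 j)).
  by move=> k; apply: CkM => //; exact: smooth_entry.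
by apply/funext => x; rewrite mxE.
Qed.

Lemma innerE d (A : 'M[R]_d) u v :
  inner A u v = \sum_j (\sum_i u 0 i * A i j) * v 0 j.
Proof. by rewrite /inner mxE; apply: eq_bigr => j _; rewrite !mxE. Qed.

Lemma innerDl d (A : 'M[R]_d) u u' v :
  inner A (u + u') v = inner A u v + inner A u' v.
Proof. by rewrite /inner !mulmxDl mxE. Qed.

Lemma innerZl d (A : 'M[R]_d) a u v : inner A (a *: u) v = a * inner A u v.
Proof. by rewrite /inner -!scalemxAl mxE. Qed.

Lemma innerZr d (A : 'M[R]_d) a u v : inner A u (a *: v) = a * inner A u v.
Proof. by rewrite /inner linearZ/= -scalemxAr mxE. Qed.

Lemma innerNl d (A : 'M[R]_d) u v : inner A (- u) v = - inner A u v.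
Proof. by rewrite -scaleN1r innerZl mulN1r. Qed.

Lemma inner_suml d (A : 'M[R]_d) (I : Type) (r : seq I) (F : I -> 'rV[R]_d) v :
  inner A (\sum_(i <- r) F i) v = \sum_(i <- r) inner A (F i) v.
Proof.
elim: r => [|i r IH]; first by rewrite !big_nil /inner !mul0mx mxE.
by rewrite !big_cons innerDl IH.
Qed.

Lemma inner_sym d (A : 'M[R]_d) u v : A^T = A -> inner A u v = inner A v u.
Proof.
move=> As; rewrite /inner -[in RHS](trmxK (v *m A *m u^T)) [RHS]mxE.
by rewrite !trmx_mul trmxK As mulmxA.
Qed.

Lemma smooth_inner (V : normedModType R) (U : set V) d (A : V -> 'M[R]_d)
    (u v : V -> 'rV[R]_d) : open U -> smooth_on U A -> smooth_on U u ->
  smooth_on U v -> smooth_on U (fun x => inner (A x) (u x) (v x)).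
Proof.
move=> oU As us vs; under eq_fun do rewrite innerE.
apply: smooth_sum => // j k; apply: CkM => //; last exact: smooth_entry.
apply: smooth_sum => // i {}k; apply: CkM => //; exact: smooth_entry.
Qed.

Lemma exists_orthonormal_frame m (U : set 'rV[R]_m) (g : 'rV[R]_m -> 'M[R]_m) :
  open U -> smooth_on U g -> (forall x, U x -> is_inner_product (g x)) ->
  exists e, orthonormal_frame U g e.
Proof.
move=> oU gs gi.
suff P k : (k <= m)%N -> exists e : nat -> 'rV[R]_m -> 'rV[R]_m,
    [/\ forall i, (i < k)%N -> smooth_on U (e i),
        forall x, U x -> forall i j, (i < k)%N -> (j < k)%N ->
          inner (g x) (e i x) (e j x) = (i == j)%:R &
        forall x, U x -> forall i (l : 'I_m), (i < k)%N -> (i < l)%N ->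
          e i x 0 l = 0].
  have [e [es eo _]] := P m (leqnn m).
  exists (fun i => e i); split=> [i|x Ux i j]; first exact: es.
  by rewrite eo.
elim: k => [|k IH] km; first by exists (fun _ _ => 0); split.
have {IH} [e [es eo et]] := IH (ltnW km).
pose dk : 'rV[R]_m := coord_vec (Ordinal km).
pose w x := dk + \sum_(j < k) (- inner (g x) dk (e j x)) *: e j x.
have ws : smooth_on U w.
  move=> l; apply: CkD => //; first exact: Ck_cst.
  apply: smooth_sum => // j; apply: smooth_scale_row => //; last exact: es.
  rewrite (_ : (fun _ => _) = fun x => inner (g x) dk (e j x) *: (-1 : R)).
    apply: smooth_scale => //; apply: smooth_inner => //; last exact: es.
    exact: smooth_cst.
  by apply/funext => x; rewrite -[RHS]/(_ * -1) mulrN1.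
have w1 x : U x -> w x 0 (Ordinal km) = 1.
  move=> Ux; rewrite mxE mxE !eqxx /= summxE big1 ?addr0// => j _.
  by rewrite mxE et// mulr0.
have wt x (l : 'I_m) : U x -> (k < l)%N -> w x 0 l = 0.
  move=> Ux kl; rewrite !mxE summxE big1 => [|j _]; last first.
    by rewrite mxE et ?mulr0// (ltn_trans _ kl).
  by rewrite addr0 eqxx/=; case: eqP => // lk; rewrite lk/= ltnn in kl.
have wo x i : U x -> (i < k)%N -> inner (g x) (w x) (e i x) = 0.
  move=> Ux ik; rewrite innerDl inner_suml (bigD1 (Ordinal ik))//= big1.
    by rewrite addr0 innerZl eo// eqxx mulr1 subrr.
  by move=> j ji; rewrite innerZl eo// (_ : (j == i :> nat) = false) ?mulr0//; exact: negPf.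
have w0 x : U x -> 0 < inner (g x) (w x) (w x).
  move=> Ux; apply: (gi x Ux).2; apply/eqP => /(congr1 (fun v : 'rV[R]_m => v 0 (Ordinal km))).
  by rewrite w1// mxE => /eqP; rewrite oner_eq0.
pose c x := inner (g x) (w x) (w x) `^ (- 2^-1).
have cs : smooth_on U c.
  by move=> l; apply: Ck_powR => //; exact: smooth_inner.
have c1 x : U x -> c x * (c x * inner (g x) (w x) (w x)) = 1.
  move=> Ux; have N0 := w0 x Ux; rewrite mulrA /c -powRD ?(gt_eqF N0) ?implybT//.
  rewrite -opprD -[2^-1 in X in - (X + _)]mul1r -[2^-1 in X in - (_ + X)]mul1r -splitr.
  by rewrite powR_inv1 ?ltW// mulVf ?gt_eqF.
have lt_cases i : (i < k.+1)%N -> i = k \/ (i < k)%N.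
  by rewrite ltnS leq_eqVlt => /orP[/eqP|]; [left|right].
exists (fun i x => if i == k then c x *: w x else e i x); split.
- move=> i /lt_cases[->|ik]; first by rewrite eqxx; exact: smooth_scale_row.
  by rewrite (ltn_eqF ik); exact: es.
- move=> x Ux i j /lt_cases[->|ik] /lt_cases[->|jk].
  + by rewrite eqxx innerZl innerZr c1.
  + by rewrite eqxx (ltn_eqF jk) innerZl wo// mulr0 eq_sym (ltn_eqF jk).
  + rewrite eqxx (ltn_eqF ik) inner_sym; last exact: (gi x Ux).1.
    by rewrite innerZl wo// mulr0.
  + by rewrite (ltn_eqF ik) (ltn_eqF jk) eo.
- move=> x Ux i l /lt_cases[->|ik] il.
  + by rewrite eqxx mxE wt// mulr0.
  + by rewrite (ltn_eqF ik) et.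
Qed.

End Frames.

Section LeviCivita.
Context {R : realType}.

Lemma is_inner_product_unit d (A : 'M[R]_d) : is_inner_product A -> A \in unitmx.
Proof.
move=> [_ Apos]; rewrite -row_free_unit -kermx_eq0; apply/rowV0P => u.
move=> /sub_kermxP uA; apply/eqP; apply: contraT => /Apos.
by rewrite /inner uA mul0mx mxE ltxx.
Qed.

Lemma derive_entry (V : normedModType R) p q (F : V -> 'M[R]_(p, q)) x v i j :
  differentiable F x -> 'D_v (fun y => F y i j) x = ('D_v F x) i j.
Proof.
move=> Fd.
pose f (A : 'M[R]_(p, q)) : R := A i j.
have lf : linear f by move=> a s t; rewrite /f !mxE.
pose L : {linear 'M[R]_(p, q) -> R} := HB.pack f (GRing.isLinear.Build _ _ _ _ _ lf).
have Lc : continuous L by exact: coord_continuous.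
have Ld y : differentiable L y by exact: linear_differentiable.
rewrite -[LHS]/('D_v (L \o F) x) deriveE; last exact: differentiable_comp.
by rewrite diff_comp// diff_lin// deriveE.
Qed.

Lemma christoffel_levi_civita d (g : 'rV[R]_d -> 'M[R]_d) (x : 'rV[R]_d) :
  (\forall y \near x, is_inner_product (g y)) -> differentiable g x ->
  (forall k i j, christoffel g x k i j = christoffel g x k j i) /\
  (forall l i j, ('D_(coord_vec l) g x) i j =
     \sum_k (christoffel g x k l i * g x k j + christoffel g x k l j * g x i k)).
Proof.
move=> gi gd.
have Dsym v i j : ('D_v g x) i j = ('D_v g x) j i.
  rewrite -!derive_entry//; apply: near_eq_derive.
  by apply: filterS gi => y [gy _]; rewrite -{1}gy mxE.
have gx := nbhs_singleton gi; have gu := is_inner_product_unit gx.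
have gxs i j : g x i j = g x j i by rewrite -{1}gx.1 mxE.
split=> [k i j|l i j].
  rewrite /christoffel; congr (_ * _); apply: eq_bigr => p _; congr (_ * _).
  by rewrite (Dsym _ i j) [X in X - _]addrC.
have lower a b c : \sum_k christoffel g x k a b * g x c k =
    2^-1 * (('D_(coord_vec a) g x) b c + ('D_(coord_vec b) g x) a c
            - ('D_(coord_vec c) g x) a b).
  rewrite /christoffel; under eq_bigr do rewrite -mulrA mulr_suml.
  rewrite -mulr_sumr exchange_big/=; congr (_ * _).
  under eq_bigr => p _.
    under eq_bigr => k _ do rewrite mulrAC [_ * g x c k]mulrC.
    rewrite -mulr_suml (_ : \sum_k _ = (g x *m invmx (g x)) c p).
      rewrite mulmxV// mxE; over.
    by rewrite mxE.
  by rewrite (bigD1 c)//= eqxx mul1r big1 ?addr0// => p /negPf; rewrite eq_sym => ->; rewrite mul0r.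
rewrite big_split/=.
under eq_bigr do rewrite gxs.
rewrite !lower (Dsym _ i j) (Dsym (coord_vec i) l j) (Dsym (coord_vec j) l i).
by field.
Qed.

End LeviCivita.

Section FrameExistence.
Context {R : realType} {m n : nat}.
Context {M : riemannian_manifold R m} {N : riemannian_manifold R n}.
Variable iota : M -> N.

Lemma exists_local_frame a b : isometric_immersion iota ->
  atlas a -> atlas b ->
  exists e, local_frame iota a b (a @` overlap iota a b) e.
Proof.
move=> [[iotac _] _] aM bN.
have sub : a @` overlap iota a b `<=` a @` chart_dom a.
  by move=> _ [p [ap _] <-]; exists p.
have oU : open (a @` overlap iota a b).
  rewrite openE => _ [p [ap bp] <-].
  have oI := @chart_img_open _ _ _ a.
  have oO : open (overlap iota a b).
    apply: openI; first exact: chart_dom_open.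
    by apply: open_comp => [q _|]; [exact: iotac|exact: chart_dom_open].
  have Ip : (a @` chart_dom a) (a p) by exists p.
  have := @chart_inv_continuous _ _ _ a.
  rewrite (continuous_open_subspace _ oI) => /(_ (a p)).
  rewrite inE => /(_ Ip) cp.
  have : \forall y \near a p, overlap iota a b (chart_inv a y).
    apply: cp; rewrite chart_mapK//; exact: open_nbhs_nbhs.
  apply: filterS2 (open_nbhs_nbhs (conj oI Ip)) => _ [q aq <-].
  by rewrite chart_mapK// => qO; exists q.
have gs : smooth_on (a @` overlap iota a b) (metric a).
  have := metric_smooth aM; move: sub; set U := _ @` _; set U' := _ @` _.
  move=> sub gs k; move: (metric a) (gs k); elim: k {gs} => [|k IH] f /=.
    by move=> fc x /sub; exact: fc.
  by move=> [fd fD]; split=> [x /sub|v]; [exact: fd|exact: IH (fD v)].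
have [e eo] := exists_orthonormal_frame oU gs (fun x Ux =>
  let: ex_intro2 p ap Ep := sub x Ux in
  ecast z (is_inner_product (metric a z)) Ep (metric_inner aM ap)).
by exists e; split.
Qed.

End FrameExistence.

(* Main.v *)
Require Import Defs.
From mathcomp Require Import all_boot all_order all_algebra.
From mathcomp Require Import all_classical all_reals all_analysis.
From mathcomp Require Import ring lra.
Set Implicit Arguments.
Unset Strict Implicit.
Unset Printing Implicit Defensive.
Import Order.TTheory GRing.Theory Num.Theory.
Import numFieldNormedType.Exports.
Local Open Scope classical_set_scope.
Local Open Scope ring_scope.

(** The statement is local, so everything happens in one chart of M and one of
N, for a local orthonormal frame e_1, ..., e_m.  Write tau for the tension
field, so that H = tau / m, and D for the connection along the immersion f.

If tau vanishes on an open set, so do its covariant derivatives, hence its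
rough Laplacian.  For the converse, let |tau| be constant.  The connection D is
metric ([leibniz_along]), so differentiating |tau|^2 gives <D_X tau, tau> = 0
for every X; differentiating <D_(e_i) tau, tau> = 0 along e_i and summing gives
  <Delta tau, tau> = sum_i |D_(e_i) tau|^2 ,
so Delta tau = 0 forces D_(e_i) tau = 0 for all i ([tensional_parallel]).  On
the other hand tau is normal to M ([tension_normal]), and differentiating
<tau, df(e_i)> = 0 along e_i turns D_(e_i) tau = 0 into
  0 = <tau, D_(e_i) df(e_i)> = <tau, II(e_i, e_i)>
by the Gauss formula ([nabla_along_push]), the tangential part of
D_(e_i) df(e_i) being orthogonal to tau.  Summing over i gives |tau|^2 = 0
([tensional_minimal]).

The geometric input is that the second fundamental form II is normal
([second_fundamental_form_normal]): <II(u, v), df(w)> is symmetric in u, v and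
skew in v, w, hence zero.  Symmetry rests on the symmetry of the Christoffel
symbols and of second derivatives ([derive_sym]), skewness on
f^*h = g and on the fact that both connections are metric.  The analytic
input is that tau is smooth, which reduces to the smoothness of the
Christoffel symbols ([smooth_christoffel]). *)

(** * Directional derivatives *)

Section ChainRule.
Context {R : realType}.
Implicit Types U V W : normedModType R.

Lemma derive_comp U V W (f : U -> V) (g : V -> W) x v :
  differentiable f x -> differentiable g (f x) ->
  'D_v (g \o f) x = 'D_('D_v f x) g (f x).
Proof.
move=> fd gd; rewrite deriveE; last exact: differentiable_comp.
by rewrite diff_comp//= -!deriveE.
Qed.

Lemma derive_dirD V W (f : V -> W) x u v : differentiable f x ->
  'D_(u + v) f x = 'D_u f x + 'D_v f x.
Proof. by move=> fd; rewrite !deriveE// linearD. Qed.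

Lemma derive_coord d W (f : 'rV[R]_d -> W) x v : differentiable f x ->
  'D_v f x = \sum_j v 0 j *: 'D_(coord_vec j) f x.
Proof.
move=> fd; rewrite deriveE// {1}(row_sum_delta v) linear_sum.
by apply: eq_bigr => j _; rewrite linearZ/= deriveE.
Qed.

Lemma derive_bigsum V W k (f : 'I_k -> V -> W) x v :
  (forall i, differentiable (f i) x) ->
  'D_v (fun y => \sum_i f i y) x = \sum_i 'D_v (f i) x.
Proof.
move=> fd; rewrite -derive_sum; last by move=> i; exact: diff_derivable.
by congr ('D_v _ x); apply/funext => y; rewrite fct_sumE.
Qed.

Lemma differentiable_bigsum V W k (f : 'I_k -> V -> W) x :
  (forall i, differentiable (f i) x) ->
  differentiable (fun y => \sum_i f i y) x.
Proof.
move=> fd; rewrite (_ : (fun _ => _) = \sum_i f i).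
  exact: differentiable_sum.
by apply/funext => y; rewrite fct_sumE.
Qed.

Lemma differentiable_entry (V : normedModType R) p q (F : V -> 'M[R]_(p, q))
    x i j : differentiable F x -> differentiable (fun y => F y i j) x.
Proof.
move=> Fd; apply: (@differentiable_comp _ _ _ _ F (fun A => A i j)) => //.
exact: differentiable_coord.
Qed.

End ChainRule.

(** * Symmetry of second derivatives *)

Section Schwarz.
Context {R : realType} {V : normedModType R}.
Implicit Types (f : V -> R) (x u v : V) (U : set V).

Lemma mean_value_along f x v (s : R) : 0 < s ->
  (forall r : R, 0 <= r <= s -> differentiable f (x + r *: v)) ->
  exists2 r, 0 <= r <= s & f (x + s *: v) - f x = 'D_v f (x + r *: v) * s.
Proof.
move=> s0 fd; pose l (r : R) := x + r *: v.
have ld r : differentiable l r.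
  apply: differentiableD; first exact: differentiable_cst.
  exact: differentiableZl.
have Dl r : 'D_1 l r = v.
  rewrite deriveD; [|exact: derivable_cst|exact/diff_derivable/differentiableZl].
  rewrite derive_cst add0r deriveE; last exact: differentiableZl.
  by rewrite diffZl//= -deriveE// derive_id scale1r.
have dfl r : r \in `]0, s[%R -> is_derive r (1 : R) (f \o l) ('D_v f (l r)).
  rewrite in_itv/= => /andP[/ltW r0 /ltW rs].
  have fdr : differentiable f (l r) by apply: fd; rewrite r0.
  apply: DeriveDef; last by rewrite derive_comp ?Dl.
  exact/diff_derivable/differentiable_comp.
have cfl : {within `[0, s], continuous (f \o l)}.
  apply: continuous_in_subspaceT => r; rewrite inE/= in_itv/= => r0s.
  exact/differentiable_continuous/differentiable_comp/fd.
have [r rs E] := MVT s0 dfl cfl.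
exists r; first by move: rs; rewrite in_itv/= => /andP[/ltW-> /ltW->].
by move: E; rewrite /= /l scale0r addr0 subr0.
Qed.

Lemma derive_translate f (a x v : V) : differentiable f (x + a) ->
  differentiable (fun y => f (y + a)) x /\
  'D_v (fun y => f (y + a)) x = 'D_v f (x + a).
Proof.
move=> fd; have td : differentiable (fun y => y + a) x.
  by apply: differentiableD => //; exact: differentiable_cst.
split; first exact: (@differentiable_comp _ _ _ _ (fun y => y + a) f).
rewrite (@derive_comp _ _ _ _ (fun y => y + a) f)// deriveD//.
by rewrite derive_id derive_cst addr0.
Qed.

(** The second difference of [f] over a parallelogram is s^2 times a mixed second
derivative at some point of it: apply the mean value theorem in the direction
[u] to the increment of [f] along [v], then in the direction [v] to 'D_u f. *)
Lemma second_difference f U x u v (s : R) : 0 < s ->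
  (forall r t : R, 0 <= r <= s -> 0 <= t <= s ->
     U (x + r *: u + t *: v)) -> Ck 2 U f ->
  exists r t : R, [/\ 0 <= r <= s, 0 <= t <= s &
    f (x + s *: u + s *: v) - f (x + s *: u) - (f (x + s *: v) - f x) =
    'D_v ('D_u f) (x + r *: u + t *: v) * s * s].
Proof.
move=> s0 sq [fd fD].
have s00 : 0 <= s <= s by rewrite ltW/=.
have z0s : (0 : R) <= 0 <= s by rewrite lexx ltW.
pose G y := f (y + s *: v) - f y.
have fd1 r : 0 <= r <= s -> differentiable f (x + r *: u + s *: v).
  by move=> rs; apply: fd; exact: sq.
have fd0 r : 0 <= r <= s -> differentiable f (x + r *: u).
  by move=> rs; apply: fd; have := sq r 0 rs z0s; rewrite scale0r addr0.
have tr r (rs : 0 <= r <= s) := derive_translate u (fd1 r rs).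
have [r rs] := @mean_value_along G x u s s0 (fun r rs =>
  differentiableB (tr r rs).1 (fd0 r rs)).
rewrite /G deriveB; [|exact/diff_derivable/(tr r rs).1|exact/diff_derivable/fd0].
rewrite (tr r rs).2.
have [t ts ->] := @mean_value_along ('D_u f) (x + r *: u) v s s0 (fun t ts =>
  (fD u).1 _ (sq r t rs ts)).
by move=> E; exists r, t; split.
Qed.

(** The second difference does not see the order of the two directions, so each
small parallelogram at [x] has a point where 'D_v 'D_u f takes the value that
'D_u 'D_v f takes at another; both derivatives being continuous, they agree at
[x] when the parallelogram shrinks. *)
Lemma derive_sym f U x u v : open U -> U x -> Ck 2 U f ->
  'D_u ('D_v f) x = 'D_v ('D_u f) x.
Proof.
move=> oU Ux f2.
have cont a b : {for x, continuous ('D_a ('D_b f))}.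
  by apply: ((f2.2 b).2 a).
apply/eqP; rewrite -subr_eq0 -normr_le0; apply/ler_addgt0Pl => e e0; rewrite addr0.
have e2 : 0 < e / 2 by rewrite divr_gt0.
have tri (p q r : R) : `|p - r| < e / 2 -> `|q - r| < e / 2 -> `|p - q| <= e.
  move=> pr qr; rewrite (splitr e) -(subrKA r) (le_trans (ler_normD _ _))//.
  by rewrite lerD ?ltW// distrC.
have cU a b : \forall y \near x,
    `|'D_a ('D_b f) x - 'D_a ('D_b f) y| < e / 2.
  by have /cvgrPdist_lt/(_ _ e2) := cont a b.
have [d /= d0 dP] := (nbhs_normP _ _).1
  (filterI (open_nbhs_nbhs (conj oU Ux)) (filterI (cU u v) (cU v u))).
(* small enough for the closed parallelogram to lie in the ball of radius d *)
pose s := d / 2 / (`|u| + `|v| + 1).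
have uv0 : 0 < `|u| + `|v| + 1 by rewrite ltr_wpDl// addr_ge0.
have s0 : 0 < s by rewrite !divr_gt0.
have near_sq r t : 0 <= r <= s -> 0 <= t <= s ->
    `|x - (x + r *: u + t *: v)| < d.
  move=> /andP[r0 rs] /andP[t0 ts].
  rewrite -addrA opprD addrA subrr add0r normrN.
  apply: le_lt_trans (ler_normD _ _) _; rewrite !normrZ !ger0_norm//.
  apply: (@le_lt_trans _ _ (s * (`|u| + `|v| + 1))).
    rewrite mulrDr mulrDr mulr1; apply: ler_wpDr; first exact: ltW.
    by apply: lerD; exact: ler_wpM2r.
  by rewrite /s divfK ?gt_eqF// ltr_pdivrMr// ltr_pMr// ltr1n.
have sqU r t rs ts := (dP _ (near_sq r t rs ts)).1.
have [r [t [rs ts E1]]] := second_difference s0 sqU f2.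
have sqU' r' t' : 0 <= r' <= s -> 0 <= t' <= s -> U (x + r' *: v + t' *: u).
  by move=> r's t's; rewrite addrAC; exact: sqU.
have [r' [t' [r's t's E2]]] := second_difference s0 sqU' f2.
have E : 'D_v ('D_u f) (x + r *: u + t *: v) =
         'D_u ('D_v f) (x + t' *: u + r' *: v).
  apply: (mulIf (lt0r_neq0 s0)); apply: (mulIf (lt0r_neq0 s0)).
  have swap (p q q' p' : R) : p - q - (q' - p') = p - q' - (q - p') by ring.
  rewrite [x + t' *: u + _]addrAC.
  rewrite [x + s *: v + _]addrAC in E2.
  exact: etrans (esym E1) (etrans (swap _ _ _ _) E2).
have [_ [A _]] := dP _ (near_sq t' r' t's r's).
have [_ [_ B]] := dP _ (near_sq r t rs ts).
rewrite -E in A.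
exact: tri A B.
Qed.

End Schwarz.

(** * Stability of smoothness *)

Section SmoothClosure.
Context {R : realType}.
Implicit Types V W : normedModType R.

Lemma smooth_differentiable V W (U : set V) (f : V -> W) x :
  smooth_on U f -> U x -> differentiable f x.
Proof. by move=> fs Ux; apply: (fs 1%N).1. Qed.

Lemma smooth_derive V W (U : set V) (f : V -> W) v :
  smooth_on U f -> smooth_on U ('D_v f).
Proof. by move=> fs k; apply: (fs k.+1).2. Qed.

Lemma smooth_subset V W (U U' : set V) (f : V -> W) : U `<=` U' ->
  smooth_on U' f -> smooth_on U f.
Proof.
move=> sub fs k; have {fs} := fs k; elim: k f => [|k IH] f /=.
  by move=> fc x /sub; exact: fc.
by move=> [fd fD]; split=> [x /sub|v]; [exact: fd|exact: IH (fD v)].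
Qed.

Lemma eq_smooth V W (U : set V) (f g : V -> W) : open U ->
  (forall x, U x -> f x = g x) -> smooth_on U f -> smooth_on U g.
Proof. by move=> oU fg fs k; exact: (eq_Ck oU fg (fs k)). Qed.

Lemma smooth_id V (U : set V) : smooth_on U (id : V -> V).
Proof.
case=> [|k]; first by move=> x _; exact: cvg_id.
split=> [x _|v]; first by [].
rewrite (_ : 'D_v id = cst v); first exact: Ck_cst.
by apply/funext => x; rewrite derive_id.
Qed.

Lemma smoothD V W (U : set V) (f g : V -> W) : open U ->
  smooth_on U f -> smooth_on U g -> smooth_on U (fun x => f x + g x).
Proof. by move=> oU fs gs k; exact: CkD. Qed.

Lemma smoothN V d (U : set V) (f : V -> 'rV[R]_d) : open U ->
  smooth_on U f -> smooth_on U (fun x => - f x).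
Proof.
move=> oU fs; under eq_fun do rewrite -scaleN1r.
by apply: smooth_scale_row => //; exact: smooth_cst.
Qed.

Lemma smoothM V (U : set V) (f g : V -> R) : open U ->
  smooth_on U f -> smooth_on U g -> smooth_on U (fun x => f x * g x).
Proof. by move=> oU fs gs k; exact: CkM. Qed.

Lemma smoothZ V (U : set V) (c : R) (f : V -> R) : open U ->
  smooth_on U f -> smooth_on U (fun x => c * f x).
Proof. by move=> oU fs; apply: smoothM => //; exact: smooth_cst. Qed.

Lemma smooth_derive_along m (U : set 'rV[R]_m) n (f : 'rV[R]_m -> 'rV[R]_n)
    (X : 'rV[R]_m -> 'rV[R]_m) : open U ->
  smooth_on U f -> smooth_on U X -> smooth_on U (fun x => 'D_(X x) f x).
Proof.
move=> oU fs Xs.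
apply: (@eq_smooth _ _ _ (fun x => \sum_j X x 0 j *: 'D_(coord_vec j) f x)) => //.
  by move=> x Ux; rewrite [RHS]derive_coord//; exact: smooth_differentiable Ux.
apply: smooth_sum => // j; apply: smooth_scale_row => //.
  exact: smooth_entry.
exact: smooth_derive.
Qed.

(** By the chain rule, a directional derivative of [p \o f] is a sum of products
of smooth functions with composites 'D_j p \o f; the induction on the order of
differentiability is therefore over all smooth [p] at once. *)
Lemma smooth_comp V n (U : set V) (U' : set 'rV[R]_n) (f : V -> 'rV[R]_n)
    (p : 'rV[R]_n -> R) : open U -> (forall x, U x -> U' (f x)) ->
  smooth_on U f -> smooth_on U' p -> smooth_on U (p \o f).
Proof.
move=> oU fU fs ps k; elim: k p ps => [|k IH] p ps.
  move=> x Ux; apply: continuous_comp; first exact: (fs 0%N).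
  exact: (ps 0%N _ (fU x Ux)).
split=> [x Ux|v].
  apply: differentiable_comp; first exact: smooth_differentiable Ux.
  exact: smooth_differentiable (fU x Ux).
apply: (@eq_Ck _ _ _ _ _ (fun x => \sum_j ('D_v f x) 0 j *
    ('D_(coord_vec j) p \o f) x)) => // [x Ux|].
  have fd := smooth_differentiable fs Ux.
  have pd := smooth_differentiable ps (fU x Ux).
  by rewrite [RHS]derive_comp//= derive_coord.
elim: (index_enum _) => [|j r IHr].
  under eq_fun do rewrite big_nil; exact: Ck_cst.
under eq_fun do rewrite big_cons; apply: CkD => //; apply: CkM => //.
  by apply: smooth_entry => //; exact: smooth_derive.
by apply: IH; exact: smooth_derive.
Qed.

(** A smooth orthonormal frame makes determinants and cofactors avoidable: if
the rows of E are orthonormal for g, then E g E^T = 1, that is g^-1 = E^T E. *)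
Lemma smooth_invmx d (U : set 'rV[R]_d) (g : 'rV[R]_d -> 'M[R]_d) k l :
  open U -> smooth_on U g -> (forall x, U x -> is_inner_product (g x)) ->
  smooth_on U (fun x => invmx (g x) k l).
Proof.
move=> oU gs gi; have [e [es eo]] := exists_orthonormal_frame oU gs gi.
apply: (@eq_smooth _ _ _ (fun x => \sum_a e a x 0 k * e a x 0 l)) => //; last first.
  by apply: smooth_sum => // a; apply: smoothM => //; exact: smooth_entry.
move=> x Ux; pose E := \matrix_(a, i) e a x 0 i.
have EgE : E *m g x *m E^T = 1%:M.
  apply/matrixP => a b; rewrite mxE [RHS]mxE -(eo x Ux) innerE.
  apply: eq_bigr => j _; rewrite !mxE; congr (_ * _).
  by apply: eq_bigr => i _; rewrite !mxE.
have gEE : g x *m (E^T *m E) = 1%:M.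
  by rewrite mulmxA; apply: mulmx1C; rewrite mulmxA.
have -> : invmx (g x) = E^T *m E.
  have gu := is_inner_product_unit (gi x Ux).
  by rewrite -[RHS](mulKmx gu) gEE mulmx1.
by rewrite mxE; apply: eq_bigr => a _; rewrite !mxE.
Qed.

Lemma smooth_christoffel d (U : set 'rV[R]_d) (g : 'rV[R]_d -> 'M[R]_d) k i j :
  open U -> smooth_on U g -> (forall x, U x -> is_inner_product (g x)) ->
  smooth_on U (fun x => christoffel g x k i j).
Proof.
move=> oU gs gi; apply: smoothZ => //; apply: smooth_sum => // l.
apply: smoothM => //; first exact: smooth_invmx.
have Ds a b c : smooth_on U (fun x => ('D_(coord_vec a) g x) b c).
  by apply: smooth_entry => //; exact: smooth_derive.
apply: smoothD => //; first exact: smoothD.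
by under eq_fun do rewrite -mulN1r; exact: smoothZ.
Qed.

Lemma smooth_christoffel_form m n (U : set 'rV[R]_m) (U' : set 'rV[R]_n)
    (h : 'rV[R]_n -> 'M[R]_n) (f X Y : 'rV[R]_m -> 'rV[R]_n) :
  open U -> open U' -> (forall x, U x -> U' (f x)) ->
  smooth_on U' h -> (forall y, U' y -> is_inner_product (h y)) ->
  smooth_on U f -> smooth_on U X -> smooth_on U Y ->
  smooth_on U (fun x => christoffel_form h (f x) (X x) (Y x)).
Proof.
move=> oU oU' fU hs hi fs Xs Ys; apply: smooth_row => // k.
under eq_fun do rewrite mxE.
apply: smooth_sum => // i; apply: smooth_sum => // j.
apply: smoothM => //; last exact: smooth_entry.
apply: smoothM => //; last exact: smooth_entry.
apply: (@smooth_comp _ _ U U' f (fun y => christoffel h y k i j)) => //.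
exact: smooth_christoffel.
Qed.

End SmoothClosure.

(** * The Levi-Civita connection is metric *)

Section MetricConnection.
Context {R : realType}.

Lemma inner_sum2 d (A : 'M[R]_d) u v :
  inner A u v = \sum_i \sum_j u 0 i * A i j * v 0 j.
Proof.
rewrite innerE exchange_big/=.
by apply: eq_bigr => j _; rewrite mulr_suml.
Qed.

Lemma innerDr d (A : 'M[R]_d) u v v' :
  inner A u (v + v') = inner A u v + inner A u v'.
Proof. by rewrite /inner linearD/= mulmxDr mxE. Qed.

Lemma innerBl d (A : 'M[R]_d) u u' v :
  inner A (u - u') v = inner A u v - inner A u' v.
Proof. by rewrite innerDl innerNl. Qed.

Lemma inner0l d (A : 'M[R]_d) v : inner A 0 v = 0.
Proof. by rewrite /inner !mul0mx mxE. Qed.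

Lemma inner0r d (A : 'M[R]_d) v : inner A v 0 = 0.
Proof. by rewrite /inner trmx0 mulmx0 mxE. Qed.

Lemma inner_sumr d (A : 'M[R]_d) (I : Type) (r : seq I) (F : I -> 'rV[R]_d) u :
  inner A u (\sum_(i <- r) F i) = \sum_(i <- r) inner A u (F i).
Proof.
elim: r => [|i r IH]; first by rewrite !big_nil inner0r.
by rewrite !big_cons innerDr IH.
Qed.

Lemma inner_ge0 d (A : 'M[R]_d) u : is_inner_product A -> 0 <= inner A u u.
Proof.
move=> [_ Ap]; have [->|/Ap/ltW//] := eqVneq u 0.
by rewrite inner0l.
Qed.

Lemma inner_eq0 d (A : 'M[R]_d) u : is_inner_product A -> inner A u u = 0 -> u = 0.
Proof.
by move=> [_ Ap] u0; apply/eqP; apply: contraT => /Ap; rewrite u0 ltxx.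
Qed.

Lemma derive_inner (V : normedModType R) d (A : V -> 'M[R]_d)
    (u v : V -> 'rV[R]_d) x w :
  differentiable A x -> differentiable u x -> differentiable v x ->
  'D_w (fun y => inner (A y) (u y) (v y)) x =
  inner ('D_w A x) (u x) (v x) + inner (A x) ('D_w u x) (v x)
  + inner (A x) (u x) ('D_w v x).
Proof.
move=> Ad ud vd.
pose t i j (y : V) : R := u y 0 i * A y i j * v y 0 j.
have td1 i j : differentiable (fun y => u y 0 i * A y i j) x.
  by apply: differentiableM; exact: differentiable_entry.
have td i j : differentiable (t i j) x.
  by apply: differentiableM => //; exact: differentiable_entry.
rewrite (_ : (fun _ => _) = fun y => \sum_i \sum_j t i j y); last first.
  by apply/funext => y; rewrite inner_sum2.
rewrite derive_bigsum => [|i]; last exact: differentiable_bigsum.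
rewrite !inner_sum2 -!big_split/=; apply: eq_bigr => i _.
rewrite derive_bigsum// -!big_split/=; apply: eq_bigr => j _.
rewrite deriveM; [|exact/diff_derivable|exact/diff_derivable/differentiable_entry].
rewrite deriveM; [|exact/diff_derivable/differentiable_entry..].
rewrite !derive_entry// /GRing.scale/=; ring.
Qed.

Lemma christoffel_form_sym d (g : 'rV[R]_d -> 'M[R]_d) x u v :
  (\forall y \near x, is_inner_product (g y)) -> differentiable g x ->
  christoffel_form g x u v = christoffel_form g x v u.
Proof.
move=> gi gd; have [sym _] := christoffel_levi_civita gi gd.
apply/rowP => k; rewrite !mxE exchange_big/=.
by apply: eq_bigr => i _; apply: eq_bigr => j _; rewrite sym mulrAC.
Qed.

Lemma inner_christoffel_form d (g : 'rV[R]_d -> 'M[R]_d) x w u v :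
  inner (g x) (christoffel_form g x w u) v =
  \sum_i \sum_j u 0 i * (\sum_l w 0 l *
    \sum_k christoffel g x k l i * g x k j) * v 0 j.
Proof.
pose t i j l k := christoffel g x k l i * w 0 l * u 0 i * g x k j * v 0 j.
transitivity (\sum_k \sum_j \sum_l \sum_i t i j l k).
  rewrite inner_sum2; apply: eq_bigr => k _; apply: eq_bigr => j _.
  rewrite mxE !mulr_suml; apply: eq_bigr => l _.
  by rewrite !mulr_suml; apply: eq_bigr => i _.
rewrite exchange_big/=.
under eq_bigr => j _.
  rewrite exchange_big/=.
  under eq_bigr => l _ do rewrite exchange_big/=.
  rewrite exchange_big/=.
  over.
rewrite exchange_big/=; apply: eq_bigr => i _; apply: eq_bigr => j _.
rewrite mulr_sumr mulr_suml; apply: eq_bigr => l _.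
rewrite !mulr_sumr mulr_suml; apply: eq_bigr => k _.
rewrite /t; ring.
Qed.

(** Covariant constancy of the metric, extended by linearity from the
coordinate directions. *)
Lemma derive_metric d (g : 'rV[R]_d -> 'M[R]_d) x w u v :
  (\forall y \near x, is_inner_product (g y)) -> differentiable g x ->
  inner ('D_w g x) u v = inner (g x) (christoffel_form g x w u) v
                         + inner (g x) u (christoffel_form g x w v).
Proof.
move=> gi gd; have [_ lc] := christoffel_levi_civita gi gd.
have gs := (nbhs_singleton gi).1.
have gxs i j : g x i j = g x j i by have /matrixP/(_ i j) := gs; rewrite mxE => ->.
rewrite [X in _ + X]inner_sym// !inner_christoffel_form.
rewrite [X in _ + X]exchange_big -big_split/= inner_sum2.
apply: eq_bigr => i _; rewrite -big_split/=; apply: eq_bigr => j _.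
have scaleE (c : R) (A : 'M[R]_d) : (c *: A) i j = c * A i j by rewrite mxE.
have -> : ('D_w g x) i j =
    \sum_l w 0 l * (\sum_k christoffel g x k l i * g x k j) +
    \sum_l w 0 l * (\sum_k christoffel g x k l j * g x k i).
  rewrite derive_coord// summxE -big_split/=; apply: eq_bigr => l _.
  rewrite -mulrDr -big_split/=; apply: etrans (scaleE _ _) _; rewrite lc.
  by congr (_ * _); apply: eq_bigr => k _; rewrite [g x i k]gxs.
ring.
Qed.

(** By the chain rule h \o f varies along X as h does along df(X), which is the
direction entering the Christoffel term of [nabla_along]; so metricity of the
connection of N passes to the induced one. *)
Lemma derive_inner_along m n (f : 'rV[R]_m -> 'rV[R]_n)
    (h : 'rV[R]_n -> 'M[R]_n) (X : 'rV[R]_m -> 'rV[R]_m)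
    (xi eta : 'rV[R]_m -> 'rV[R]_n) x :
  (\forall y \near f x, is_inner_product (h y)) -> differentiable h (f x) ->
  differentiable f x -> differentiable xi x -> differentiable eta x ->
  'D_(X x) (fun y => inner (h (f y)) (xi y) (eta y)) x =
  inner (h (f x)) (nabla_along f h X xi x) (eta x) +
  inner (h (f x)) (xi x) (nabla_along f h X eta x).
Proof.
move=> hi hd fd xd ed.
have hfd : differentiable (h \o f) x by exact: differentiable_comp.
rewrite (@derive_inner _ _ (h \o f))// derive_comp// derive_metric//.
rewrite /nabla_along innerDl innerDr /push; ring.
Qed.

End MetricConnection.

(** * Differentiating along a vector field *)

Section Along.
Context {R : realType}.

Lemma differentiable_scale_row (V : normedModType R) n (c : V -> R)
    (F : V -> 'rV[R]_n) x : differentiable c x -> differentiable F x ->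
  differentiable (fun y => c y *: F y) x.
Proof.
move=> cd Fd.
rewrite (_ : (fun _ => _) = fun y => \sum_k (c y * F y 0 k) *: coord_vec k).
  apply: differentiable_bigsum => k; apply: differentiableZl.
  by apply: differentiableM => //; exact: differentiable_entry.
apply/funext => y; rewrite [LHS]row_sum_delta.
by apply: eq_bigr => k _; rewrite mxE.
Qed.

Lemma derive_scale_row (V : normedModType R) n (c : V -> R)
    (F : V -> 'rV[R]_n) x w : differentiable c x -> differentiable F x ->
  'D_w (fun y => c y *: F y) x = 'D_w c x *: F x + c x *: 'D_w F x.
Proof.
move=> cd Fd; apply/rowP => k; rewrite !mxE -!derive_entry//; last first.
  exact: differentiable_scale_row.
rewrite (_ : (fun _ => _) = c * (fun y => F y 0 k)); last first.
  by apply/funext => y; rewrite mxE.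
rewrite deriveM; [|exact/diff_derivable|exact/diff_derivable/differentiable_entry].
by rewrite [LHS]addrC; congr (_ + _); exact: mulrC.
Qed.

Lemma derive_derive_along m n (U : set 'rV[R]_m) (f : 'rV[R]_m -> 'rV[R]_n)
    (Y : 'rV[R]_m -> 'rV[R]_m) x w :
  open U -> U x -> smooth_on U f -> differentiable Y x ->
  'D_w (fun y => 'D_(Y y) f y) x = 'D_w ('D_(Y x) f) x + 'D_('D_w Y x) f x.
Proof.
move=> oU Ux fs Yd.
have Dd j : differentiable ('D_(coord_vec j) f) x.
  exact: smooth_differentiable (smooth_derive _ fs) Ux.
have Yd' j : differentiable (fun y => Y y 0 j) x.
  exact: differentiable_entry.
have sd j (c : 'rV[R]_m -> R) : differentiable c x ->
    differentiable (fun y => c y *: 'D_(coord_vec j) f y) x.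
  by move=> cd; exact: differentiable_scale_row.
have expand Z : \forall y \near x,
    'D_(Z y) f y = \sum_j Z y 0 j *: 'D_(coord_vec j) f y.
  apply: filterS (open_nbhs_nbhs (conj oU Ux)) => y Uy.
  by rewrite derive_coord//; exact: smooth_differentiable Uy.
have -> := near_eq_derive w (expand Y).
have -> := near_eq_derive w (expand (cst (Y x))).
rewrite !derive_bigsum => [|j|j]; last 2 first.
- by apply: sd; exact: differentiable_cst.
- exact: sd.
rewrite [X in _ + X]derive_coord; last exact: smooth_differentiable Ux.
rewrite -big_split; apply: eq_bigr => j _ /=.
rewrite (derive_scale_row w (Yd' j) (Dd j)) addrC.
congr (_ + _); first by congr (_ *: _); exact: derive_entry.
have cd : differentiable (cst (Y x 0 j) : 'rV[R]_m -> R) x.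
  exact: differentiable_cst.
apply/esym/(etrans (derive_scale_row w cd (Dd j))).
by rewrite derive_cst scale0r add0r.
Qed.

End Along.

(** * Isometric immersions in coordinates *)

Record local_isometric_immersion (R : realType) m n (U : set 'rV[R]_m)
    (U' : set 'rV[R]_n) (g : 'rV[R]_m -> 'M[R]_m) (h : 'rV[R]_n -> 'M[R]_n)
    (f : 'rV[R]_m -> 'rV[R]_n) : Prop := LocalIsometricImmersion {
  imm_dom_open : open U ;
  imm_cod_open : open U' ;
  imm_image : forall x, U x -> U' (f x) ;
  imm_smooth : smooth_on U f ;
  imm_dom_smooth : smooth_on U g ;
  imm_cod_smooth : smooth_on U' h ;
  imm_dom_inner : forall x, U x -> is_inner_product (g x) ;
  imm_cod_inner : forall y, U' y -> is_inner_product (h y) ;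
  imm_pullback : forall x, U x -> forall u v,
    inner (g x) u v = inner (h (f x)) ('D_u f x) ('D_v f x) }.

(** Defined on vectors: the Hessian of f corrected by both connections, which is
(nabla df)(u, v).  [nabla_along_push] relates it to vector fields. *)
Definition second_fundamental_form (R : realType) m n (g : 'rV[R]_m -> 'M[R]_m)
    (h : 'rV[R]_n -> 'M[R]_n) (f : 'rV[R]_m -> 'rV[R]_n) (x u v : 'rV[R]_m)
    : 'rV[R]_n :=
  'D_u ('D_v f) x + christoffel_form h (f x) ('D_u f x) ('D_v f x)
  - 'D_(christoffel_form g x u v) f x.

Section LocalImmersion.
Context {R : realType} {m n : nat}.
Context {U : set 'rV[R]_m} {U' : set 'rV[R]_n}.
Context {g : 'rV[R]_m -> 'M[R]_m} {h : 'rV[R]_n -> 'M[R]_n}.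
Context {f : 'rV[R]_m -> 'rV[R]_n}.
Context (imm : local_isometric_immersion U U' g h f).

Let oU := imm_dom_open imm.
Let fs := imm_smooth imm.
Let gs := imm_dom_smooth imm.
Local Notation II := (second_fundamental_form g h f).
Local Notation hdot x u v := (inner (h (f x)) u v).

Let nearU x : U x -> \forall y \near x, U y.
Proof. by move=> Ux; exact: open_nbhs_nbhs. Qed.

Lemma near_dom_inner x : U x -> \forall y \near x, is_inner_product (g y).
Proof. by move=> /nearU; apply: filterS; exact: (imm_dom_inner imm). Qed.

Lemma near_cod_inner x : U x -> \forall y \near f x, is_inner_product (h y).
Proof.
move=> /(imm_image imm) U'fx.
apply: filterS (open_nbhs_nbhs (conj (imm_cod_open imm) U'fx)).
exact: (imm_cod_inner imm).
Qed.

Lemma cod_inner x : U x -> is_inner_product (h (f x)).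
Proof. by move=> /near_cod_inner; exact: nbhs_singleton. Qed.

Lemma inner_along_sym x u v : U x -> hdot x u v = hdot x v u.
Proof. by move=> /cod_inner[hs _]; exact: inner_sym. Qed.

Lemma smooth_push X : smooth_on U X -> smooth_on U (push f X).
Proof. by move=> Xs; exact: smooth_derive_along. Qed.

Lemma smooth_nabla X Y : smooth_on U X -> smooth_on U Y ->
  smooth_on U (nabla g X Y).
Proof.
move=> Xs Ys; apply: smoothD => //; first exact: smooth_derive_along.
apply: (@smooth_christoffel_form _ _ _ U U g id) => //.
- exact: (imm_dom_inner imm).
- exact: smooth_id.
Qed.

Lemma smooth_nabla_along X xi : smooth_on U X -> smooth_on U xi ->
  smooth_on U (nabla_along f h X xi).
Proof.
move=> Xs xis; apply: smoothD => //; first exact: smooth_derive_along.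
apply: (@smooth_christoffel_form _ _ _ U U') => //.
- exact: (imm_cod_open imm).
- exact: (imm_image imm).
- exact: (imm_cod_smooth imm).
- exact: (imm_cod_inner imm).
- exact: smooth_push.
Qed.

Lemma smooth_tension (e : 'I_m -> 'rV[R]_m -> 'rV[R]_m) :
  (forall i, smooth_on U (e i)) -> smooth_on U (tension g h f e).
Proof.
move=> es; apply: smooth_sum => // i; apply: smoothD => //.
  by apply: smooth_nabla_along => //; exact: smooth_push.
by apply: smoothN => //; apply: smooth_push; exact: smooth_nabla.
Qed.

Lemma leibniz_along X xi eta x : U x -> smooth_on U xi -> smooth_on U eta ->
  'D_(X x) (fun y => hdot y (xi y) (eta y)) x =
  hdot x (nabla_along f h X xi x) (eta x) + hdot x (xi x) (nabla_along f h X eta x).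
Proof.
move=> Ux xis etas; apply: derive_inner_along; first exact: near_cod_inner.
- exact: smooth_differentiable (imm_cod_smooth imm) (imm_image imm Ux).
- exact: smooth_differentiable Ux.
- exact: smooth_differentiable Ux.
- exact: smooth_differentiable Ux.
Qed.

Lemma leibniz_along_cst X xi eta (c : R) : smooth_on U xi -> smooth_on U eta ->
  (forall x, U x -> hdot x (xi x) (eta x) = c) -> forall x, U x ->
  hdot x (nabla_along f h X xi x) (eta x) + hdot x (xi x) (nabla_along f h X eta x) = 0.
Proof.
move=> xis etas cE x Ux; rewrite -leibniz_along//.
rewrite (@near_eq_derive _ _ _ _ (cst c)) ?derive_cst//.
by apply: filterS (nearU Ux) => y; exact: cE.
Qed.

(** The Gauss formula.  The derivative of Y in 'D_X (df(Y)) is absorbed by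
df(nabla_X Y), so what remains depends on the vectors X x and Y x only. *)
Lemma nabla_along_push X Y x : U x -> smooth_on U Y ->
  nabla_along f h X (push f Y) x = II x (X x) (Y x) + push f (nabla g X Y) x.
Proof.
move=> Ux Ys; rewrite /nabla_along /push (derive_derive_along _ oU)//; last first.
  exact: smooth_differentiable Ux.
rewrite /nabla derive_dirD; last exact: smooth_differentiable Ux.
have regroup (A B C D : 'rV[R]_n) : A + B + C = A + C - D + (B + D).
  by rewrite [B + D]addrC addrA subrK addrAC.
exact: regroup.
Qed.

Lemma second_fundamental_form_sym x u v : U x -> II x u v = II x v u.
Proof.
move=> Ux; have gx := near_dom_inner Ux; have hx := near_cod_inner Ux.
have gd := smooth_differentiable gs Ux.
have hd := smooth_differentiable (imm_cod_smooth imm) (imm_image imm Ux).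
have mixed : 'D_u ('D_v f) x = 'D_v ('D_u f) x.
  apply/rowP => k.
  have DD a b : ('D_a ('D_b f) x) 0 k = 'D_a ('D_b (fun y => f y 0 k)) x.
    rewrite -derive_entry; last exact: smooth_differentiable (smooth_derive b fs) Ux.
    apply: near_eq_derive; apply: filterS (nearU Ux) => y Uy.
    by rewrite derive_entry//; exact: smooth_differentiable fs Uy.
  have f2 : Ck 2 U (fun y => f y 0 k) by exact: smooth_entry.
  apply: etrans (DD u v) _; apply: etrans (esym (DD v u)).
  exact: derive_sym oU Ux f2.
rewrite /second_fundamental_form mixed (christoffel_form_sym u v gx gd).
by rewrite (christoffel_form_sym ('D_u f x) ('D_v f x) hx hd).
Qed.

(** Differentiate <df v, df w> = g(v, w) along [u], for constant coordinate
fields v and w.  The connection of N gives <D_u df v, df w> + <df v, D_u df w>,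
that of M the same expression with df(nabla_u v), df(nabla_u w) in place of
D_u df v, D_u df w; the differences are II(u, v) and II(u, w). *)
Lemma second_fundamental_form_skew x u v w : U x ->
  hdot x (II x u v) ('D_w f x) + hdot x (II x u w) ('D_v f x) = 0.
Proof.
have cancel_tangential (a b c d p q : R) :
    p = c + a -> q = d + b -> a + b = p + q -> c + d = 0 by lra.
move=> Ux.
have gd : differentiable g x by exact: smooth_differentiable Ux.
have metric_side : 'D_u (fun y => inner (g y) v w) x =
    inner (g x) (christoffel_form g x u v) w
    + inner (g x) v (christoffel_form g x u w).
  have cd (a : 'rV[R]_m) : differentiable (cst a : 'rV[R]_m -> 'rV[R]_m) x.
    exact: differentiable_cst.
  apply: etrans (derive_inner u gd (cd v) (cd w)) _.
  rewrite !derive_cst inner0l inner0r !addr0.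
  exact: derive_metric (near_dom_inner Ux) gd.
have same : 'D_u (fun y => inner (g y) v w) x =
    'D_u (fun y => hdot y ('D_v f y) ('D_w f y)) x.
  apply: near_eq_derive; apply: filterS (nearU Ux) => y Uy.
  exact: imm_pullback imm _ Uy _ _.
have ambient_side := @leibniz_along (cst u) ('D_v f) ('D_w f) x Ux
  (smooth_derive v fs) (smooth_derive w fs).
have E a : nabla_along f h (cst u) ('D_a f) x =
    II x u a + 'D_(christoffel_form g x u a) f x by rewrite /II subrK.
have Ev : hdot x (nabla_along f h (cst u) ('D_v f) x) ('D_w f x) =
    hdot x (II x u v) ('D_w f x) + inner (g x) (christoffel_form g x u v) w.
  by rewrite E innerDl (imm_pullback imm Ux).
have Ew : hdot x ('D_v f x) (nabla_along f h (cst u) ('D_w f) x) =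
    hdot x (II x u w) ('D_v f x) + inner (g x) v (christoffel_form g x u w).
  apply: etrans (inner_along_sym _ _ Ux) _; rewrite E innerDl; congr (_ + _).
  by apply: etrans (inner_along_sym _ _ Ux) _; rewrite (imm_pullback imm Ux).
apply: (cancel_tangential _ _ _ _ _ _ Ev Ew).
exact: etrans (esym metric_side) (etrans same ambient_side).
Qed.

(** A trilinear form symmetric in its first two arguments and skew in its last two
vanishes, as for the uniqueness of the Levi-Civita connection: six alternate
swaps lead back to the start with the opposite sign. *)
Lemma second_fundamental_form_normal x u v w : U x ->
  hdot x (II x u v) ('D_w f x) = 0.
Proof.
have eq_opp0 (t : R) : t = - t -> t = 0 by lra.
move=> Ux; pose T a b c := hdot x (II x a b) ('D_c f x).
have sym a b c : T a b c = T b a c.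
  by rewrite /T (second_fundamental_form_sym a b Ux).
have skew a b c : T a b c = - T a c b.
  by apply/esym/addr0_eq; exact: second_fundamental_form_skew.
apply: (eq_opp0 (T u v w)).
by rewrite {1}skew sym skew sym skew sym !opprK.
Qed.

Lemma tension_second_fundamental_form e x : U x ->
  (forall i, smooth_on U (e i)) ->
  tension g h f e x = \sum_i II x (e i x) (e i x).
Proof.
move=> Ux es; apply: eq_bigr => i _.
by apply: etrans (congr1 (+%R^~ _) (nabla_along_push (e i) Ux (es i))) (addrK _ _).
Qed.

Lemma tension_normal e x w : U x -> (forall i, smooth_on U (e i)) ->
  hdot x (tension g h f e x) ('D_w f x) = 0.
Proof.
move=> Ux es; rewrite tension_second_fundamental_form// inner_suml big1// => i _.
exact: second_fundamental_form_normal.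
Qed.

(** The Bochner argument: two derivatives of the constant |xi|^2 give
<Delta xi, xi> = sum_i |D_(e_i) xi|^2. *)
Lemma tensional_parallel e (xi : 'rV[R]_m -> 'rV[R]_n) (c : R) :
  (forall i, smooth_on U (e i)) -> smooth_on U xi ->
  (forall x, U x -> hdot x (xi x) (xi x) = c) ->
  (forall x, U x -> rough_laplacian g h f e xi x = 0) ->
  forall x, U x -> forall i, nabla_along f h (e i) xi x = 0.
Proof.
have double_eq0 (t : R) : t + t = 0 -> t = 0 by lra.
move=> es xis norm_c lap0 x Ux.
have orth X y : U y -> hdot y (nabla_along f h X xi y) (xi y) = 0.
  move=> Uy; apply: double_eq0; apply: etrans (leibniz_along_cst X xis xis norm_c Uy).
  by congr (_ + _); exact: inner_along_sym.
have Ds i : smooth_on U (nabla_along f h (e i) xi) by exact: smooth_nabla_along.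
have DD i : hdot x (nabla_along f h (e i) (nabla_along f h (e i) xi) x) (xi x) =
    - hdot x (nabla_along f h (e i) xi x) (nabla_along f h (e i) xi x).
  apply/eqP; rewrite -addr_eq0; apply/eqP.
  by have := leibniz_along_cst (e i) (Ds i) xis (orth (e i)) Ux.
have := congr1 (fun v => hdot x v (xi x)) (lap0 x Ux).
rewrite /rough_laplacian inner0l innerNl inner_suml.
under eq_bigr => i _ do rewrite innerBl (orth _ _ Ux) subr0 DD.
rewrite sumrN opprK => /psumr_eq0P D0 i.
apply: (inner_eq0 (cod_inner Ux)); apply: D0 => // j _.
exact: inner_ge0 (cod_inner Ux).
Qed.

(** A section that is both parallel and normal is orthogonal to II(e_i, e_i),
and tau is the sum of these. *)
Lemma tensional_minimal e (c : R) :
  (forall i, smooth_on U (e i)) ->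
  (forall x, U x -> hdot x (tension g h f e x) (tension g h f e x) = c) ->
  (forall x, U x -> rough_laplacian g h f e (tension g h f e) x = 0) ->
  forall x, U x -> tension g h f e x = 0.
Proof.
move=> es norm_c lap0 x Ux.
have ts := smooth_tension es.
have par := tensional_parallel es ts norm_c lap0 Ux.
apply: (inner_eq0 (cod_inner Ux)).
rewrite {2}tension_second_fundamental_form// inner_sumr big1// => i _.
have := leibniz_along_cst (e i) ts (smooth_push (es i))
  (fun y Uy => tension_normal (e i y) Uy es) Ux.
rewrite par inner0l add0r (nabla_along_push (e i) Ux (es i)) innerDr.
by rewrite (tension_normal _ Ux es) addr0.
Qed.

Lemma nabla_along_eq0 X xi : (forall x, U x -> xi x = 0) ->
  forall x, U x -> nabla_along f h X xi x = 0.
Proof.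
move=> xi0 x Ux; rewrite /nabla_along xi0//.
rewrite (@near_eq_derive _ _ _ _ (cst 0)); last first.
  by apply: filterS (nearU Ux) => y; exact: xi0.
rewrite derive_cst add0r; apply/rowP => k; rewrite !mxE.
by rewrite big1// => i _; rewrite big1// => j _; rewrite mxE mulr0.
Qed.

Lemma rough_laplacian_eq0 e xi : (forall x, U x -> xi x = 0) ->
  forall x, U x -> rough_laplacian g h f e xi x = 0.
Proof.
move=> xi0 x Ux; rewrite /rough_laplacian big1 ?oppr0// => i _.
rewrite nabla_along_eq0// => [|y Uy]; last exact: nabla_along_eq0.
by rewrite nabla_along_eq0// subr0.
Qed.

End LocalImmersion.

(** * From the manifolds to coordinates *)

Section Frames.
Context {R : realType} {m n : nat}.
Context {M : riemannian_manifold R m} {N : riemannian_manifold R n}.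
Variable iota : M -> N.

Lemma local_frame_immersion a b W e : isometric_immersion iota ->
  local_frame iota a b W e ->
  local_isometric_immersion W (b @` chart_dom b) (metric a) (metric b)
    (local_rep iota a b).
Proof.
move=> [[_ fs] fi] [aM bN oW sub _].
have repE p : chart_dom a p -> local_rep iota a b (a p) = b (iota p).
  by move=> ap; rewrite /local_rep/= chart_mapK.
split=> //.
- exact: chart_img_open.
- by move=> x /sub[p [ap bp] <-]; rewrite repE//; exists (iota p).
- exact: smooth_subset sub (fs _ _ aM bN).
- apply: smooth_subset (metric_smooth aM).
  by move=> x /sub[p [ap _] <-]; exists p.
- exact: metric_smooth.
- by move=> x /sub[p [ap _] <-]; exact: metric_inner.
- by move=> _ [p bp <-]; exact: metric_inner.
- move=> x /sub[p [ap bp] <-] u v; rewrite repE//.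
  exact: (fi _ _ aM bN p (conj ap bp)).2.
Qed.

End Frames.

Theorem theorem5p1 (R : realType) (m n : nat) (m_gt0 : (0 < m)%N)
    (M : riemannian_manifold R m) (N : riemannian_manifold R n)
    (M_connected : connected [set: M]) (iota : M -> N)
    (iota_isom : isometric_immersion iota)
    (H_const : constant_mean_curvature_norm iota) :
  H_tensional iota <-> minimal iota.
Proof.
have m0 : (m%:R : R) != 0 by rewrite pnatr_eq0 -lt0n.
split=> [tensional|min] a b W e frame.
  have imm := local_frame_immersion iota_isom frame.
  have [_ _ _ _ [es _]] := frame.
  have [c cE] := H_const.
  move=> x Wx; rewrite /mean_curvature.
  (* |tau| = m |H|, hence the constant value m^2 c^2 of |tau|^2 *)
  rewrite (tensional_minimal (c := m%:R * (m%:R * c ^+ 2)) imm es) ?scaler0//.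
    move=> y Wy; rewrite -(cE a b W e frame y Wy)/=.
    rewrite sqr_sqrtr; last exact: inner_ge0 (cod_inner imm Wy).
    by rewrite /mean_curvature innerZl innerZr !mulVKf.
  by move=> y Wy; exact: tensional Wy.
move=> x Wx /=; apply: (rough_laplacian_eq0 (local_frame_immersion iota_isom frame)) => //.
move=> y Wy; have /eqP := min a b W e frame y Wy.
by rewrite scaler_eq0 invr_eq0 (negPf m0) => /eqP.
Qed.
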